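(* Let $G$ be a binary quasigroup of order $n$ with operation $*$ on $\{1,\ldots,n\}$, let $k\ge 1$ be an integer, and for $d\ge 2$ let $M(G^{[d-1]})$ be the $d$-dimensional MDS code of the $(d-1)$-iterated quasigroup $G$. (1) For every even $d\ge 2$, $\mathrm{Per}_k M(G^{[d-1]})>0$. If for some odd $d'$ we have $\mathrm{Per}_k M(G^{[d'-1]})>0$, then $\mathrm{Per}_k M(G^{[d-1]})>0$ for all $d\ge d'$. (2) There exists a constant $c(G,k)>0$ such that $$\lim_{d\to\infty}\frac{\mathrm{Per}_k M(G^{[d-1]})}{\left(\frac{(kn)!}{k!^n}\right)^{d-2}}=c(G,k),$$ where the limit is taken over all $d$ for which $\mathrm{Per}_k M(G^{[d-1]})$ is nonzero.
   Context: A binary quasigroup of order $n$ is a binary operation $*$ on $\{1,\ldots,n\}$ such that for all $a,b$ each of the equations $a*x=b$ and $x*a=b$ has a unique solution $x$. For $m\ge 1$, the MDS code $M(G^{[m]})$ of the $m$-iterated quasigroup $G$ is the $(m+1)$-dimensional $(0,1)$-array of order $n$ with indices $(x_0,x_1,\ldots,x_m)\in\{1,\ldots,n\}^{m+1}$, whose entry is $1$ iff $(\cdots((x_0*x_1)*x_2)*\cdots)*x_m=1$. For a $D$-dimensional array $A=(a_\alpha)$ of order $n$, a hyperplane is the set of indices with one fixed coordinate value; a $k$-multiplex is a multiset $K$ of $kn$ indices in $\{1,\ldots,n\}^D$ such that every hyperplane contains exactly $k$ elements of $K$ counted with multiplicity; a $k$-plex is a $k$-multiplex with no repeated elements. The $k$-multipermanent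 is $\mathrm{Per}_k A=\sum_{K}\prod_{\alpha\in K}a_\alpha$ over all $k$-multiplexes $K$ (product with multiplicity); for a $(0,1)$-array it equals the number of $k$-multiplexes all of whose elements lie in the support of $A$. *)

(* Defs.v *)
From HB Require Import structures.
From mathcomp Require Import all_boot all_order all_algebra.
From mathcomp Require Import all_classical all_reals all_analysis.

Set Implicit Arguments.
Unset Strict Implicit.
Unset Printing Implicit Defensive.

Import Order.TTheory GRing.Theory Num.Theory.

Local Open Scope ring_scope.

(* The set {1, ..., n} is represented by 'I_n, the ordinal of value i standing
   for the element i + 1. *)

Definition is_quasigroup (n : nat) (op : 'I_n -> 'I_n -> 'I_n) : Prop :=
  forall a b : 'I_n,
    (exists! x : 'I_n, op a x = b) /\ (exists! x : 'I_n, op x a = b).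

Definition multi_index (D n : nat) : finType := {ffun 'I_D -> 'I_n}.

Definition array (R : Type) (D n : nat) : Type := multi_index D n -> R.

(* A multiset of k * n indices is given by its multiplicity function; each
   multiplicity is at most k * n, so bounding them by k * n loses nothing and
   makes the type finite. *)
Definition multiplicity (D n k : nat) : finType :=
  {ffun multi_index D n -> 'I_(k * n).+1}.

Definition is_multiplex (D n k : nat) (K : multiplicity D n k) : bool :=
  (\sum_(a : multi_index D n) K a == k * n)%N &&
  [forall i : 'I_D, forall v : 'I_n,
     (\sum_(a : multi_index D n | a i == v) K a == k)%N].

Definition multipermanent (R : comNzRingType) (D n k : nat)
    (A : array R D n) : R :=
  \sum_(K : multiplicity D n k | is_multiplex K)
    \prod_(a : multi_index D n) A a ^+ K a.

Definition iterated_op (n : nat) (op : 'I_n -> 'I_n -> 'I_n) (m : nat)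
    (x : multi_index m.+1 n) : 'I_n :=
  foldl op (x ord0) [seq x (lift ord0 i) | i <- enum 'I_m].

(* The element 1 of {1, ..., n} is the ordinal of value 0. *)
Definition MDS_code (R : comNzRingType) (n : nat) (op : 'I_n -> 'I_n -> 'I_n)
    (m : nat) : array R m.+1 n :=
  fun x => (nat_of_ord (iterated_op op x) == 0%N)%:R.
Arguments MDS_code R [n] op m x.

(* Main.v *)
(* Labelling the elements of a k-multiplex by the numbers below k n turns it into a
   sequence of d balanced functions f_0, ..., f_(d-1) from 'I_(k * n) to 'I_n (every value
   is taken k times) whose pointwise iterated product is the constant function o. As
   f |-> o * f permutes the balanced functions, these sequences are the closed walks of
   length d at o in the graph on all functions with edges g -> g * f, f balanced.

   Every vertex has N = (k n)! / k!^n outgoing edges, and right multiplication by f is a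
   permutation, so an edge can be undone by going around its cycle: by going around twice,
   in an odd number of steps. Hence the set of vertices reaching o in an even number of steps
   is closed under two steps, and Doeblin's contraction argument on this set shows that the
   return probabilities converge along the lengths for which they do not vanish, the
   period being 1 or 2.

   A multiplex without repeated elements has (k n)! labellings; the labellings
   of the others have two equal elements, and for n >= 2 there are O((N - 1)^d) of these. *)

Require Import Defs.
From HB Require Import structures.
From mathcomp Require Import all_boot all_order all_algebra.
From mathcomp Require Import all_classical all_reals all_analysis.
From mathcomp Require Import perm zify ring lra.
Import Order.TTheory GRing.Theory Num.Theory.
Import numFieldNormedType.Exports.

(** * Functions on ['I_M] with prescribed multiplicities: multinomial coefficients *)

Definition ffun_cons {T : finType} {m : nat} (v : T) (F : {ffun 'I_m -> T}) :
  {ffun 'I_m.+1 -> T} := [ffun i => if unlift ord0 i is Some j then F j else v].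

Lemma ffun_cons0 (T : finType) (m : nat) (v : T) (F : {ffun 'I_m -> T}) :
  ffun_cons v F ord0 = v.
Proof. by rewrite ffunE unlift_none. Qed.

Lemma ffun_consS (T : finType) (m : nat) (v : T) (F : {ffun 'I_m -> T}) (j : 'I_m) :
  ffun_cons v F (lift ord0 j) = F j.
Proof. by rewrite ffunE liftK. Qed.

Lemma big_ffun_ordS (T : finType) (m : nat) (G : {ffun 'I_m.+1 -> T} -> nat) :
  \sum_F G F = \sum_v \sum_F G (ffun_cons v F).
Proof.
rewrite pair_big /= (reindex (fun u : T * {ffun 'I_m -> T} => ffun_cons u.1 u.2)) //=.
exists (fun F : {ffun _ -> _} => (F ord0, [ffun j => F (lift ord0 j)])) => [[v F] _|F _].
  by rewrite ffun_cons0; congr pair; apply/ffunP => j; rewrite ffunE ffun_consS.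
by apply/ffunP => i; case: (unliftP ord0 i) => [j|] ->; rewrite ?ffun_cons0 ?ffun_consS ?ffunE.
Qed.

Definition mult {M : nat} {X : finType} (c : {ffun 'I_M -> X}) (x : X) : nat :=
  \sum_(t < M) (c t == x).

(** The multinomial coefficient, with its denominator multiplied out so as to stay in [nat]. By
    induction on [M]: fixing the first value to be [v] lowers [kappa v] by one and contributes
    [kappa v] times the factorial of the smaller size; since the [kappa v] add up to the full size,
    the next factorial results. *)
Lemma multinomial_card (X : finType) (M : nat) (kappa : X -> nat) :
  \sum_x kappa x = M ->
  (\sum_(c : {ffun 'I_M -> X} | [forall x, mult c x == kappa x]) 1)
    * \prod_x (kappa x)`! = M`!.
Proof.
elim: M kappa => [|M IHM] kappa sumk.
  have k0 x : kappa x = 0.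
    by apply/eqP; move/eqP: sumk; rewrite sum_nat_eq0 => /forall_inP; apply.
  rewrite [X in _ * X]big1 ?muln1 => [|x _]; last by rewrite k0.
  rewrite (eq_bigl predT) => [|c]; first by rewrite sum1_card card_ffun card_ord expn0.
  by apply/forallP => x; rewrite /mult big_ord0 k0.
rewrite big_mkcond big_ffun_ordS big_distrl /=.
have E v : (\sum_(c : {ffun 'I_M -> X})
    (if [forall x, mult (ffun_cons v c) x == kappa x] then 1 else 0))
    * \prod_x (kappa x)`! = kappa v * M`!.
  have multS c x : mult (ffun_cons v c) x = (v == x) + mult c x.
    rewrite /mult big_ord_recl ffun_cons0; congr addn.
    by apply: eq_bigr => t _; rewrite ffun_consS.
  have [kv0|kv_gt0] := posnP (kappa v).
    rewrite kv0 mul0n big1 // => c _; case: forallP => // /(_ v).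
    by rewrite multS eqxx kv0.
  rewrite -(IHM (fun x => kappa x - (v == x))); last first.
    apply/eqP; rewrite -(eqn_add2r 1) [X in _ == X]addn1 -sumk [X in _ == X](bigD1 v) //=.
    rewrite [X in X + _](bigD1 v) //= eqxx addnAC subnK //; apply/eqP; congr addn.
    by apply: eq_bigr => x; rewrite eq_sym => /negPf ->; rewrite subn0.
  have -> : \prod_x (kappa x)`! = kappa v * \prod_x (kappa x - (v == x))`!.
    rewrite (bigD1 v) //= [X in _ = _ * X](bigD1 v) //= eqxx mulnA subn1.
    rewrite -[in LHS](prednK kv_gt0) factS prednK //; congr muln.
    by apply: eq_bigr => x; rewrite eq_sym => /negPf ->; rewrite subn0.
  rewrite mulnCA -big_mkcond /=; congr (_ * (_ * _)).
  apply: eq_bigl => c; apply: eq_forallb => x; rewrite multS.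
  by case: (v =P x) => [<-|_]; rewrite ?subn0 // -(eqn_add2l 1 _ (_ - _)) subnKC.
by rewrite (eq_bigr _ (fun v _ => E v)) -big_distrl /= sumk factS.
Qed.

Lemma sum_mult (M : nat) (X : finType) (c : {ffun 'I_M -> X}) (P : pred X) :
  \sum_(x | P x) mult c x = \sum_t P (c t).
Proof.
rewrite exchange_big /=; apply: eq_bigr => t _; case Pt: (P (c t)).
  rewrite (bigD1 (c t)) //= eqxx big1 // => x /andP[_].
  by rewrite eq_sym => /negPf ->.
by rewrite big1 // => x Px; case: eqP Pt => // ->; rewrite Px.
Qed.

Lemma prod_mult (M : nat) (X : finType) (c : {ffun 'I_M -> X}) (b : X -> nat) :
  \prod_x b x ^ mult c x = \prod_t b (c t).
Proof.
under eq_bigr do rewrite /mult expn_sum.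
rewrite exchange_big /=; apply: eq_bigr => t _.
rewrite (bigD1 (c t)) //= eqxx big1 ?muln1 // => x.
by rewrite eq_sym => /negPf ->.
Qed.

Lemma mult_le (M : nat) (X : finType) (c : {ffun 'I_M -> X}) (x : X) :
  mult c x <= M.
Proof.
rewrite -[leqRHS]card_ord -sum1_card; apply: leq_sum => t _; exact: leq_b1.
Qed.

Lemma mult_comp_inj {M : nat} {X Y : finType} {f : X -> Y} (c : {ffun 'I_M -> X}) (x : X) :
  injective f -> mult [ffun t => f (c t)] (f x) = mult c x.
Proof.
by move=> f_inj; apply: eq_bigr => t _; rewrite ffunE (inj_eq f_inj).
Qed.

(** * Balanced functions and labellings of multiplexes *)

Definition balanced {n k : nat} (f : {ffun 'I_(k * n) -> 'I_n}) : bool :=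
  [forall v, mult f v == k].

Lemma balanced_comp_inj (n k : nat) (f : 'I_n -> 'I_n) (c : {ffun 'I_(k * n) -> 'I_n}) :
  injective f -> balanced [ffun t => f (c t)] = balanced c.
Proof.
move=> f_inj; have [g fK gK] := injF_bij f_inj.
apply/forallP/forallP => H v.
  by rewrite -(mult_comp_inj c v f_inj) H.
by rewrite -[v]gK mult_comp_inj.
Qed.

Lemma card_balanced (n k : nat) :
  #|@balanced n k| * k`! ^ n = (k * n)`!.
Proof.
rewrite -(@multinomial_card 'I_n (k * n) (fun=> k)); last by rewrite sum_nat_const card_ord mulnC.
by rewrite prod_nat_const card_ord sum1_card.
Qed.

Lemma balanced_gt0 (n k : nat) : 0 < #|@balanced n k|.
Proof. by have := fact_gt0 (k * n); rewrite -card_balanced muln_gt0 => /andP[]. Qed.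

Definition coordinate {D n M : nat} (L : {ffun 'I_M -> multi_index D n}) (i : 'I_D) :
  {ffun 'I_M -> 'I_n} := [ffun t => L t i].

Definition labelled {D n k : nat} (L : {ffun 'I_(k * n) -> multi_index D n}) : bool :=
  [forall i, balanced (coordinate L i)].

(** The labellings are partitioned by their multiplicity functions, and such a function is a
    multiplex exactly when all coordinates of the labelling are balanced. *)
Lemma multiplex_labelled (D n k : nat) (G : {ffun 'I_(k * n) -> multi_index D n} -> nat) :
  \sum_(K : multiplicity D n k | is_multiplex K)
    \sum_(L : {ffun 'I_(k * n) -> multi_index D n} | [forall a, mult L a == K a]) G L
  = \sum_(L | labelled L) G L.
Proof.
pose h (L : {ffun 'I_(k * n) -> multi_index D n}) : multiplicity D n k :=
  [ffun a => inord (mult L a)].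
have hE L a : h L a = mult L a :> nat by rewrite ffunE inordK // ltnS mult_le.
have lE L : is_multiplex (h L) = labelled L.
  rewrite /is_multiplex (eq_bigr _ (fun a _ => hE L a)) sum_mult /= sum1_card card_ord eqxx /=.
  apply: eq_forallb => i; apply: eq_forallb => v.
  rewrite (eq_bigr _ (fun a _ => hE L a)) sum_mult.
  by congr (_ == _); apply: eq_bigr => t _; rewrite ffunE.
rewrite [RHS](partition_big h (@is_multiplex D n k)) /=; last by move=> L; rewrite lE.
apply: eq_bigr => K mK; apply: eq_bigl => L.
apply/forallP/andP => [HL|[_ /eqP <-] a]; last by rewrite hE.
suff hL : h L = K by rewrite -lE hL mK.
by apply/ffunP => a; apply: val_inj; rewrite /= hE; apply/eqP.
Qed.

(** By [multinomial_card], the number of labellings of [K] is the factorial of [k * n] divided by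
    those of the multiplicities. Weighting each labelling by the latter makes every multiplex count
    equally often. *)
Lemma fact_multiplexes (D n k : nat) (b : multi_index D n -> nat) :
  (k * n)`! * (\sum_(K : multiplicity D n k | is_multiplex K) \prod_a b a ^ K a)
  = \sum_(L : {ffun 'I_(k * n) -> multi_index D n} | labelled L)
      (\prod_t b (L t)) * \prod_a (mult L a)`!.
Proof.
rewrite big_distrr -multiplex_labelled /=; apply: eq_bigr => K /andP[/eqP sumK _].
rewrite -(multinomial_card _ _ (fun a => K a) sumK) -mulnA big_distrl.
apply: eq_bigr => L /forallP LK.
rewrite /= mul1n mulnC -prod_mult; congr muln; apply: eq_bigr => a _; by rewrite (eqP (LK a)).
Qed.

(** * Labellings supported in the code as closed walks *)

Definition nwalk {V : finType} (B : pred V) (act : V -> V -> V) (o : V) (m : nat) (g : V) :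
    nat :=
  \sum_(F : {ffun 'I_m -> V} | [forall i, B (F i)])
    (foldl act g [seq F i | i <- enum 'I_m] == o).

Lemma forall_ffun_cons (V : finType) (B : pred V) (m : nat) (v : V) (F : {ffun 'I_m -> V}) :
  [forall i, B (ffun_cons v F i)] = B v && [forall i, B (F i)].
Proof.
apply/forallP/andP => [H|[Bv /forallP H] i].
  split; first by rewrite -(ffun_cons0 _ _ v F).
  by apply/forallP => i; rewrite -(ffun_consS _ _ v F).
by case: (unliftP ord0 i) => [j|] ->; rewrite ?ffun_cons0 ?ffun_consS.
Qed.

Lemma map_ffun_cons (V : finType) (m : nat) (v : V) (F : {ffun 'I_m -> V}) :
  [seq ffun_cons v F (lift ord0 i) | i <- enum 'I_m] = [seq F i | i <- enum 'I_m].
Proof. by apply: eq_map => i; rewrite ffun_consS. Qed.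

Lemma sum_ffun_cons (V : finType) (B : pred V) (m : nat) (G : V -> {ffun 'I_m -> V} -> nat)
    (G' : {ffun 'I_m.+1 -> V} -> nat) :
  (forall v F, G' (ffun_cons v F) = G v F) ->
  \sum_(F : {ffun 'I_m.+1 -> V} | [forall i, B (F i)]) G' F
  = \sum_(v | B v) \sum_(F : {ffun 'I_m -> V} | [forall i, B (F i)]) G v F.
Proof.
move=> GG'; rewrite big_mkcond big_ffun_ordS [RHS]big_mkcond; apply: eq_bigr => v _.
under eq_bigr => F _ do rewrite forall_ffun_cons GG'.
by case: (B v) => /=; rewrite ?big1_eq // [RHS]big_mkcond.
Qed.

Lemma nwalkS (V : finType) (B : pred V) (act : V -> V -> V) (o : V) (m : nat) (g : V) :
  nwalk B act o m.+1 g = \sum_(v | B v) nwalk B act o m (act g v).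
Proof.
apply: sum_ffun_cons => v F.
by rewrite enum_ordSl /= -map_comp ffun_cons0 map_ffun_cons.
Qed.

Definition pointwise {M n : nat} (op : 'I_n -> 'I_n -> 'I_n) (g f : {ffun 'I_M -> 'I_n}) :
  {ffun 'I_M -> 'I_n} := [ffun t => op (g t) (f t)].

Lemma foldl_pointwise (M n : nat) (op : 'I_n -> 'I_n -> 'I_n) (g : {ffun 'I_M -> 'I_n})
    (s : seq {ffun 'I_M -> 'I_n}) (t : 'I_M) :
  foldl (pointwise op) g s t = foldl op (g t) [seq f t | f : {ffun _ -> _} <- s].
Proof. by elim: s g => //= f s IHs g; rewrite IHs ffunE. Qed.

Definition transpose {D n M : nat} (F : {ffun 'I_D -> {ffun 'I_M -> 'I_n}}) :
  {ffun 'I_M -> multi_index D n} := [ffun t => [ffun i => F i t]].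

Lemma big_labelled (D n k : nat) (G : {ffun 'I_(k * n) -> multi_index D n} -> nat) :
  \sum_(L | labelled L) G L
  = \sum_(F : {ffun 'I_D -> {ffun 'I_(k * n) -> 'I_n}} | [forall i, balanced (F i)])
      G (transpose F).
Proof.
rewrite (reindex transpose) /=; last first.
  exists (fun L => [ffun i => coordinate L i]) => [F|L] _;
    by apply/ffunP => i; apply/ffunP => t; rewrite !ffunE.
apply: eq_bigl => F; apply: eq_forallb => i; congr balanced.
by apply/ffunP => t; rewrite !ffunE.
Qed.

Lemma quasigroup_inj_l (n : nat) (op : 'I_n -> 'I_n -> 'I_n) (a : 'I_n) :
  is_quasigroup op -> injective (op a).
Proof.
move=> qop x y xy; have [[z [_ zP]] _] := qop a (op a x).
by rewrite -(zP x) // -(zP y).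
Qed.

Lemma quasigroup_inj_r (n : nat) (op : 'I_n -> 'I_n -> 'I_n) (a : 'I_n) :
  is_quasigroup op -> injective (op^~ a).
Proof.
move=> qop x y xy; have [_ [z [_ zP]]] := qop a (op x a).
by rewrite -(zP x) // -(zP y).
Qed.

Definition zero_ffun (M n : nat) (n_gt0 : 0 < n) : {ffun 'I_M -> 'I_n} :=
  [ffun=> Ordinal n_gt0].

Definition in_code {m n : nat} (op : 'I_n -> 'I_n -> 'I_n) (x : multi_index m.+1 n) : bool :=
  nat_of_ord (iterated_op op x) == 0.

Lemma labelled_walk (n k m : nat) (op : 'I_n -> 'I_n -> 'I_n) (n_gt0 : 0 < n) :
  is_quasigroup op ->
  \sum_(L : {ffun 'I_(k * n) -> multi_index m.+1 n} | labelled L) \prod_t in_code op (L t)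
  = nwalk balanced (pointwise op) (zero_ffun (k * n) n n_gt0) m.+1 (zero_ffun (k * n) n n_gt0).
Proof.
move=> qop; set o := zero_ffun _ _ _.
have act_bij : bijective (pointwise op o).
  apply: injF_bij => f1 f2 /ffunP E; apply/ffunP => t; move: (E t); rewrite !ffunE.
  exact: quasigroup_inj_l.
have act_bal f : balanced (pointwise op o f) = balanced f.
  rewrite -(balanced_comp_inj _ _ _ f (quasigroup_inj_l n op (Ordinal n_gt0) qop)).
  by congr balanced; apply/ffunP => t; rewrite !ffunE.
(* The iterated product starts at its first coordinate, the walk at [o]. Substituting
   [pointwise op o] in the first step makes the vertex reached after that step the first coordinate
   itself. *)
rewrite nwalkS (eq_bigl _ _ (fun f => esym (act_bal f))).
have onb : {on [pred f | balanced (n := n) (k := k) f], bijective (pointwise op o)}.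
  exact: onW_bij.
rewrite -(reindex _ onb (F := nwalk balanced (pointwise op) o m)) /=.
rewrite -(sum_ffun_cons _ _ _ _ (fun F : {ffun 'I_m.+1 -> {ffun 'I_(k * n) -> 'I_n}} =>
  (foldl (pointwise op) (F ord0) [seq F (lift ord0 i) | i <- enum 'I_m] == o) : nat));
  last by move=> v F; rewrite ffun_cons0 map_ffun_cons.
rewrite big_labelled; apply: eq_bigr => F _.
(* The endpoint equals [o] iff it does so at every label, so the indicator of a closed walk is a
   product of indicators over the labels. *)
rewrite (eq_bigr (fun t => nat_of_bool
    (foldl (pointwise op) (F ord0) [seq F (lift ord0 i) | i <- enum 'I_m] t == o t))).
  set h := foldl _ _ _; case: (h =P o) => [->|ne]; first by rewrite big1 // => t _; rewrite eqxx.
  have /forallPn[t ne_t] : ~~ [forall t, h t == o t].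
    by apply/forallP => E; apply: ne; apply/ffunP => t; apply/eqP.
  by rewrite (bigD1 t) //= (negPf ne_t).
move=> t _; rewrite foldl_pointwise -map_comp /in_code /iterated_op !ffunE.
rewrite -val_eqE /=; congr (nat_of_bool (nat_of_ord (foldl _ _ _) == _)).
by apply: eq_map => i; rewrite !ffunE.
Qed.

(** * Comparing multiplexes with labellings: the cost of repeated elements *)

Lemma prod_mult_fact_le (M : nat) (X : finType) (c : {ffun 'I_M -> X}) :
  \prod_x (mult c x)`! <= M`!.
Proof.
have sumc : \sum_x mult c x = M by rewrite (sum_mult _ _ c predT) sum1_card card_ord.
(* The cofactor is the number of functions with the multiplicities of [c], and [c] is one of
   them. *)
rewrite -(multinomial_card _ _ _ sumc) leq_pmull // sum1_card; apply/card_gt0P.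
by exists c; rewrite unfold_in; apply/forallP => x.
Qed.

Lemma prod_mult_fact_inj (M : nat) (X : finType) (c : {ffun 'I_M -> X}) :
  injective c -> \prod_x (mult c x)`! = 1.
Proof.
move=> c_inj; apply: big1 => x _; suff: mult c x <= 1 by case: (mult c x) => [|[]].
case: (pickP (fun t => c t == x)) => [t /eqP <-|no]; last first.
  by rewrite /mult big1 // => t _; rewrite no.
rewrite /mult (bigD1 t) //= eqxx big1 // => t' ne; by rewrite (inj_eq c_inj) (negPf ne).
Qed.

Lemma prod_mult_fact_gt0 (M : nat) (X : finType) (c : {ffun 'I_M -> X}) :
  0 < \prod_x (mult c x)`!.
Proof. by apply: prodn_gt0 => x; apply: fact_gt0. Qed.

(** Some balanced function separates [t] from [t']: if a given one does not, [n > 1] provides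
    another value, [k > 0] a point [s] where it is taken, and exchanging [t'] with [s] keeps the
    function balanced. *)
Lemma card_balanced_eq (n k : nat) (t t' : 'I_(k * n)) :
  1 < n -> 0 < k -> t != t' ->
  #|[pred f : {ffun 'I_(k * n) -> 'I_n} | balanced f && (f t == f t')]| < #|@balanced n k|.
Proof.
move=> n_gt1 k_gt0 tt'; apply: proper_card; apply/properP.
split; first by apply/fintype.subsetP => f /andP[].
suff [f bf ft] : exists2 f : {ffun 'I_(k * n) -> 'I_n}, balanced f & f t != f t'.
  by exists f => //; rewrite inE (negPf ft) andbF.
have /card_gt0P[f bf] := balanced_gt0 n k.
have [ftt'|?] := eqVneq (f t) (f t'); last by exists f.
have [v ne_v] : exists v, v != f t.
  have : 0 < #|predC1 (f t)|.
    by rewrite cardC1 card_ord; case: n n_gt1 {t t' tt' f bf ftt'} => [|[]].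
  by case/card_gt0P => v; rewrite inE; exists v.
have [s fs] : exists s, f s = v.
  have /eqP := forallP bf v; case: (pickP (fun s => f s == v)) => [s /eqP ? _|nov].
    by exists s.
  by rewrite /mult big1 => [/esym k0|t'' _]; [rewrite k0 in k_gt0|rewrite nov].
have st : s != t by apply: contraNneq ne_v => <-; rewrite fs.
exists [ffun x => f (tperm t' s x)]; last first.
  by rewrite !ffunE tpermL tpermD ?fs 1?eq_sym // eq_sym.
apply/forallP => u; rewrite -[X in X == _](_ : mult f u = _) ?(forallP bf) //.
by rewrite /mult (reindex_inj (@perm_inj _ (tperm t' s))); apply: eq_bigr => x _; rewrite ffunE.
Qed.

(** Two labels carry the same index iff all coordinates agree on them, and the coordinates of a
    labelling are chosen independently; hence the power. *)
Lemma labelled_collision (D n k : nat) (t t' : 'I_(k * n)) :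
  \sum_(L : {ffun 'I_(k * n) -> multi_index D n} | labelled L) (L t == L t')
  = #|[pred f : {ffun 'I_(k * n) -> 'I_n} | balanced f && (f t == f t')]| ^ D.
Proof.
rewrite big_labelled -[X in _ ^ X]card_ord -card_ffun_on -sum1_card.
rewrite big_mkcond [RHS]big_mkcond; apply: eq_bigr => F _.
have -> : (transpose F t == transpose F t') = [forall i, F i t == F i t'].
  apply/eqP/forallP => [/ffunP E i|E]; first by have := E i; rewrite !ffunE => ->.
  by apply/ffunP => i; rewrite !ffunE; apply/eqP.
have -> : (F \in ffun_on [pred f : {ffun _ -> _} | balanced f && (f t == f t')])
    = [forall i, balanced (F i)] && [forall i, F i t == F i t'].
  apply/ffun_onP/andP => [H|[/forallP H1 /forallP H2] i]; last by rewrite inE H1 H2.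
  by split; apply/forallP => i; have /andP[] := H i.
by case: [forall i, balanced (F i)].
Qed.

(** This is the [k]-multipermanent of the code, kept in [nat] for the counting. *)
Definition num_multiplex {m n : nat} (k : nat) (op : 'I_n -> 'I_n -> 'I_n) : nat :=
  \sum_(K : multiplicity m.+1 n k | is_multiplex K) \prod_a in_code op a ^ K a.

Definition num_labelled {m n : nat} (k : nat) (op : 'I_n -> 'I_n -> 'I_n) : nat :=
  \sum_(L : {ffun 'I_(k * n) -> multi_index m.+1 n} | labelled L) \prod_t in_code op (L t).

Lemma num_labelled_le (m n k : nat) (op : 'I_n -> 'I_n -> 'I_n) :
  @num_labelled m n k op <= (k * n)`! * @num_multiplex m n k op.
Proof.
rewrite fact_multiplexes; apply: leq_sum => L _.
by rewrite leq_pmulr // prod_mult_fact_gt0.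
Qed.

Lemma num_multiplex_le (m n k : nat) (op : 'I_n -> 'I_n -> 'I_n) :
  @num_multiplex m n k op <= @num_labelled m n k op.
Proof.
rewrite -(leq_pmul2l (fact_gt0 (k * n))) fact_multiplexes [leqRHS]mulnC big_distrl /=.
by apply: leq_sum => L _; rewrite leq_mul2l prod_mult_fact_le orbT.
Qed.

Lemma num_multiplex_gt0 (m n k : nat) (op : 'I_n -> 'I_n -> 'I_n) :
  (0 < @num_multiplex m n k op) = (0 < @num_labelled m n k op).
Proof.
apply/idP/idP => [h|h]; first exact: leq_trans h (num_multiplex_le _ _ _ _).
by have := leq_trans h (num_labelled_le _ _ _ _); rewrite muln_gt0 => /andP[].
Qed.

(** Injective labellings have weight 1 in [fact_multiplexes], so only labellings with a collision
    contribute to the excess, each at most the factorial of [k * n]. A union bound over the ordered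
    pairs of labels counts them, each pair costing at least one balanced function per coordinate. *)
Lemma num_multiplex_excess (m n k : nat) (op : 'I_n -> 'I_n -> 'I_n) :
  1 < n -> 0 < k ->
  (k * n)`! * @num_multiplex m n k op
  <= @num_labelled m n k op + (k * n)`! * ((k * n) ^ 2 * (#|@balanced n k|.-1) ^ m.+1).
Proof.
move=> n_gt1 k_gt0; rewrite fact_multiplexes.
set c := ((k * n) ^ 2 * _)%N.
have le_c : \sum_(L : {ffun 'I_(k * n) -> multi_index m.+1 n} | labelled L)
    \sum_(t < k * n) \sum_(t' < k * n | t != t') (L t == L t') <= c.
  rewrite exchange_big /=.
  have -> : c = \sum_(t < k * n) \sum_(t' < k * n) (#|@balanced n k|.-1) ^ m.+1.
    by rewrite !sum_nat_const card_ord mulnA.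
  apply: leq_sum => t _; rewrite exchange_big big_mkcond; apply: leq_sum => t' _.
  case: ifP => // tt'; rewrite labelled_collision leq_exp2r //.
  by have := card_balanced_eq n k t t' n_gt1 k_gt0 tt'; lia.
apply: leq_trans (leq_add (leqnn _) (leq_mul (leqnn _) le_c)).
rewrite big_distrr -big_split /=; apply: leq_sum => L _.
have [/injectiveP L_inj|/injectivePn[t [t' tt' Ltt']]] := boolP (injectiveb L).
  by rewrite prod_mult_fact_inj // muln1 leq_addr.
apply: leq_trans (leq_addl _ _).
rewrite mulnC leq_mul ?prod_mult_fact_le //.
apply: (@leq_trans 1).
  by elim/big_rec: _ => // t'' x _ le_x1; case: in_code; rewrite ?mul1n.
by rewrite (bigD1 t) //= (bigD1 t') //= Ltt' eqxx.
Qed.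

(** For [n = 1] there is a single index, hence at most one multiplex. This case is separate because
    all labels then collide. *)
Lemma num_multiplex1 (m k : nat) (op : 'I_1 -> 'I_1 -> 'I_1) : @num_multiplex m 1 k op <= 1.
Proof.
apply: (@leq_trans #|@is_multiplex m.+1 1 k|).
  rewrite -sum1_card; apply: leq_sum => K _.
  elim/big_rec: _ => // a x _ le_x1; case: in_code; rewrite ?exp1n ?mul1n //.
  by case: (posnP (K a)) => [->|/exp0n ->]; rewrite ?mul1n.
apply/card_le1_eqP => K K' /andP[/eqP sK _] /andP[/eqP sK' _].
have aE (a b : multi_index m.+1 1) : a = b by apply/ffunP => i; rewrite !ord1.
apply/ffunP => a; apply: val_inj; move: sK sK' => /=.
rewrite !(big_pred1 a) => [-> ->|b|b] //; by rewrite /= (aE b a) eqxx.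
Qed.

Local Open Scope classical_set_scope.
Local Open Scope ring_scope.

(** * Hitting probabilities of the random walk *)

Section Walk.
Variables (R : realType) (V F : finType) (B : pred F) (act : V -> F -> V) (o : V).
Hypothesis B_gt0 : (0 < #|B|)%N.

Definition avg (phi : V -> R) (g : V) : R := (\sum_(f | B f) phi (act g f)) / #|B|%:R.

(* Probability that the random walk with uniform steps in [B], started at [g], is at [o]
   after [m] steps. *)
Definition hit (m : nat) : V -> R := iter m avg (fun g => (g == o)%:R).

Lemma avg_cst (c : R) (g : V) : avg (fun=> c) g = c.
Proof. by rewrite /avg sumr_const -[c *+ _]mulr_natr mulfK // pnatr_eq0 -lt0n. Qed.

Lemma ler_avg (phi psi : V -> R) (g : V) :
  (forall f, B f -> phi (act g f) <= psi (act g f)) -> avg phi g <= avg psi g.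
Proof. by move=> le_f; rewrite ler_wpM2r ?invr_ge0 ?ler0n // ler_sum. Qed.

(** [avg] is linear and fixes constants, and [hit m] is the [m]-fold average of the indicator of
    [o]. *)
Lemma iter_avg_affine (m : nat) (phi : V -> R) (c e : R) (g : V) :
  iter m avg (fun h => phi h - c - e * (h == o)%:R) g
  = iter m avg phi g - c - e * hit m g.
Proof.
elim: m g => [|m IHm] g //=; rewrite /avg (eq_bigr _ (fun f _ => IHm (act g f))).
rewrite !sumrB -mulr_sumr !mulrBl mulrA; congr (_ - _ - _).
exact: avg_cst.
Qed.

Lemma hit_ge0 (m : nat) (g : V) : 0 <= hit m g.
Proof.
elim: m g => [|m IHm] g /=; first exact: ler0n.
by rewrite -(avg_cst 0 g); apply: ler_avg.
Qed.

Lemma hit_le1 (m : nat) (g : V) : hit m g <= 1.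
Proof.
elim: m g => [|m IHm] g /=; first by rewrite /hit /= lern1 leq_b1.
by rewrite -(avg_cst 1 g); apply: ler_avg.
Qed.

Lemma hitS_gt0P (m : nat) (g : V) :
  reflect (exists2 f, B f & 0 < hit m (act g f)) (0 < hit m.+1 g).
Proof.
have N_gt0 : 0 < #|B|%:R^-1 :> R by rewrite invr_gt0 ltr0n.
apply: (iffP idP) => [|[f Bf hf]]; last first.
  rewrite /hit /= /avg pmulr_lgt0 // (bigD1 f) //= ltr_pwDl //.
  by apply: sumr_ge0 => ? _; apply: hit_ge0.
rewrite /hit /= /avg pmulr_lgt0 // => s_gt0.
have [||f /andP[Bf hf]] := @psumr_neq0P _ _ B (fun f => hit m (act g f)).
- by move=> f _; apply: hit_ge0.
- by apply/eqP; rewrite gt_eqF.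
by exists f.
Qed.

Lemma hitD_gt0 (a b : nat) (g : V) : 0 < hit a g -> 0 < hit b o -> 0 < hit (a + b) g.
Proof.
elim: a g => [|a IHa] g; first by rewrite /hit /= ltr0n lt0b => /eqP ->.
move=> /hitS_gt0P[f Bf hf] hb; rewrite addSn; apply/hitS_gt0P.
by exists f => //; apply: IHa.
Qed.

Lemma hit_iter_gt0 (f : F) (j m : nat) (g : V) :
  B f -> 0 < hit m (iter j (act^~ f) g) -> 0 < hit (j + m) g.
Proof.
move=> Bf; elim: j g => [|j IHj] g //; rewrite iterSr => /IHj h.
by rewrite addSn; apply/hitS_gt0P; exists f.
Qed.

Hypothesis act_inj : forall f, B f -> injective (act^~ f).

(* [act^~ f] is a permutation of a finite set, so going around its cycle twice, minus
   one step, undoes an edge in an odd number of steps. *)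
Lemma hit_back (f : F) (m : nat) (g : V) :
  B f -> 0 < hit m g -> exists2 j, odd j & 0 < hit (j + m) (act g f).
Proof.
move=> Bf hg; pose q := fingraph.order (act^~ f) g.
have q_gt0 : (0 < q)%N by apply: fingraph.order_gt0.
exists (q + q).-1; first by move: q_gt0; lia.
apply: (@hit_iter_gt0 f) => //; rewrite -iterSr prednK ?addn_gt0 ?q_gt0 //.
by rewrite iterD !iter_order //; apply: act_inj.
Qed.

Hypothesis hit2_gt0 : 0 < hit 2 o.

Lemma hit_double_gt0 (m : nat) : 0 < hit m.*2 o.
Proof.
elim: m => [|m IHm]; first by rewrite /hit /= eqxx.
by rewrite doubleS -addn2 hitD_gt0.
Qed.

(** * Doeblin contraction and convergence of the return probabilities *)

Definition evenly : set V := fun g => exists m, 0 < hit m.*2 g.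

Lemma evenly_o : evenly o.
Proof. by exists 0%N; apply: (hit_double_gt0 0). Qed.

(** Each of the two edges is undone in an odd number of steps, so together they cost an even
    number. *)
Lemma evenly_act2 (f1 f2 : F) (g : V) :
  B f1 -> B f2 -> evenly g -> evenly (act (act g f1) f2).
Proof.
move=> B1 B2 [m hg]; have [i oi hi] := hit_back f1 _ _ B1 hg.
have [j oj hj] := hit_back f2 _ _ B2 hi; exists ((j + i)./2 + m)%N.
by rewrite doubleD even_halfK ?oddD ?oi ?oj // -addnA.
Qed.

(** Each state of [evenly] has its own even hitting time; closed walks at [o] of any even length
    extend all of them to one common time, their sum over the finite set of states. *)
Lemma evenly_uniform :
  exists r, exists2 delta, 0 < delta <= 1 & forall g, evenly g -> delta <= hit r.*2 g.
Proof.
have [r hr] : exists r, forall g, evenly g -> 0 < hit r.*2 g.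
  have [m hm] : {m : V -> nat & forall g, evenly g -> 0 < hit (m g).*2 g}.
    apply: (@choice _ _ (fun g m => evenly g -> 0 < hit m.*2 g)) => g.
    by have [[m hm]|ne] := pselect (evenly g); [exists m|exists 0%N].
  exists (\sum_g m g)%N => g eg; rewrite (bigD1 g) //= doubleD.
  by apply: hitD_gt0; [apply: hm|apply: hit_double_gt0].
exists r; exists (\big[Num.min/1]_(g | `[< evenly g >]) hit r.*2 g).
  rewrite bigmin_le_id andbT; apply: lt_bigmin => // g /asboolP; exact: hr.
by move=> g eg; apply: bigmin_le_cond; apply/asboolP.
Qed.

Definition between (a b : R) (phi : V -> R) : Prop := forall g, evenly g -> a <= phi g <= b.

Lemma between_avg2 (a b : R) (phi : V -> R) : between a b phi -> between a b (avg (avg phi)).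
Proof.
move=> H g eg; rewrite -[a](avg_cst _ g) -[b](avg_cst _ g).
apply/andP; split; apply: ler_avg => f1 B1.
  rewrite -[a](avg_cst _ (act g f1)); apply: ler_avg => f2 B2.
  by have /andP[] := H _ (evenly_act2 _ _ _ B1 B2 eg).
rewrite -[b](avg_cst _ (act g f1)); apply: ler_avg => f2 B2.
by have /andP[] := H _ (evenly_act2 _ _ _ B1 B2 eg).
Qed.

Lemma between_double (a b : R) (m : nat) (phi : V -> R) :
  between a b phi -> between a b (iter m.*2 avg phi).
Proof. by move=> H; elim: m => [//|m IHm]; rewrite doubleS /=; apply: between_avg2. Qed.


(* Doeblin contraction: [phi - a - (phi o - a) 1_o] is nonnegative on
   [evenly], and [hit r.*2] is the image of [1_o]; likewise for the upper bound. *)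
Lemma between_contract (r : nat) (delta a b : R) (phi : V -> R) :
    (forall g, evenly g -> delta <= hit r.*2 g) -> between a b phi ->
  let a' := a + (phi o - a) * delta in
  between a' (a' + (1 - delta) * (b - a)) (iter r.*2 avg phi).
Proof.
move=> dr H a' g eg; have /andP[ao ob] := H o evenly_o; have dg := dr g eg.
have lo : 0 <= iter r.*2 avg (fun h => phi h - a - (phi o - a) * (h == o)%:R) g.
  have : between 0 (b - a) (fun h => phi h - a - (phi o - a) * (h == o)%:R).
    move=> h eh; have /andP[ah hb] := H h eh.
    by case: eqP => [->|_]; rewrite ?mulr1 ?mulr0; lra.
  by move=> /(between_double _ _ r) /(_ g eg) /andP[].
have hi : iter r.*2 avg (fun h => phi h - b - (phi o - b) * (h == o)%:R) g <= 0.
  have : between (a - b) 0 (fun h => phi h - b - (phi o - b) * (h == o)%:R).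
    move=> h eh; have /andP[ah hb] := H h eh.
    by case: eqP => [->|_]; rewrite ?mulr1 ?mulr0; lra.
  by move=> /(between_double _ _ r) /(_ g eg) /andP[].
rewrite !iter_avg_affine in lo hi.
have := mulr_ge0 (_ : 0 <= phi o - a) (_ : 0 <= hit r.*2 g - delta).
have := mulr_ge0 (_ : 0 <= b - phi o) (_ : 0 <= hit r.*2 g - delta).
rewrite !subr_ge0 => /(_ ob dg) ? /(_ ao dg) ?; by rewrite /a'; apply/andP; split; lra.
Qed.

Lemma hit_bounds : exists r, exists2 delta : R, 0 < delta <= 1 &
  exists2 a : nat -> R, 0 < a 1%N &
    forall j m, (j * r <= m)%N -> between (a j) (a j + (1 - delta) ^+ j) (hit m.*2).
Proof.
have [r [delta d01 dr]] := evenly_uniform; exists r; exists delta => //.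
(* The recursion is the new lower end [a'] of [between_contract]. As [hit 0 o] is 1, it gives
   [a 1 = delta], which will keep the limit positive. *)
pose a := fix a j := if j is i.+1 then a i + (hit (i * r).*2 o - a i) * delta else 0 : R.
exists a; first by rewrite /= /hit /= eqxx subr0 add0r mul1r; case/andP: d01.
move=> j m /subnK <-; rewrite doubleD /hit iterD -/(hit _); apply: between_double.
elim: j => [|j IHj].
  by move=> g _; rewrite expr0 add0r; apply/andP; split; [apply: hit_ge0|apply: hit_le1].
have := between_contract r delta _ _ _ dr IHj.
rewrite -iterD -doubleD -mulSn.
by rewrite exprS addrAC subrr add0r.
Qed.

(* If some odd number of steps closes up at [o], then every state from which [o] can be
   reached is [evenly]; otherwise [hit d o] vanishes for all odd [d]. *)
Lemma between_odd (d : nat) (a b : R) (m : nat) (phi : V -> R) :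
  odd d -> 0 < hit d o -> between a b phi -> between a b (iter m avg phi).
Proof.
move=> od hd H; elim: m => [//|m IHm] g [i hg] /=.
rewrite -[a](avg_cst _ g) -[b](avg_cst _ g).
have ev f : B f -> evenly (act g f).
  move=> Bf; have [j oj hj] := hit_back f _ _ Bf hg.
  have := hitD_gt0 _ _ _ hj hd.
  by exists (j + i.*2 + d)./2; rewrite even_halfK // !oddD oj od odd_double.
by apply/andP; split; apply: ler_avg => f Bf; have /andP[] := IHm _ (ev f Bf).
Qed.

Lemma hit_cvg : exists2 c : R, 0 < c &
  forall e, 0 < e -> exists D, forall d, (D <= d)%N -> 0 < hit d o -> `|c - hit d o| <= e.
Proof.
have [r [delta /andP[d0 d1] [a a1 H]]] := hit_bounds.
(* The intervals of stages [i] and [j] share a point, the return probability at a common later even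
   time, so any lower end is below any upper end. The limit is then the supremum of the lower
   ends. *)
have le_ab i j : a i <= a j + (1 - delta) ^+ j.
  have mi : (i * r <= maxn i j * r)%N by rewrite leq_mul2r leq_maxl orbT.
  have mj : (j * r <= maxn i j * r)%N by rewrite leq_mul2r leq_maxr orbT.
  have /andP[+ _] := H i _ mi o evenly_o; have /andP[_ +] := H j _ mj o evenly_o.
  by move=> h1 h2; apply: le_trans h1.
pose A := range a.
have ubA : has_ubound A by exists (a 0%N + (1 - delta) ^+ 0) => _ [i _ <-].
have a_le j : a j <= sup A by apply: ub_le_sup => //; exists j.
have le_b j : sup A <= a j + (1 - delta) ^+ j.
  by apply: ge_sup; [exists (a 0%N); exists 0%N|move=> _ [i _ <-]].
exists (sup A); first exact: lt_le_trans (a_le 1%N).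
move=> e e0; have [j hj] : exists j, (1 - delta) ^+ j <= e.
  have cv : (1 - delta) ^+ j @[j --> \oo] --> 0.
    by apply: cvg_expr; rewrite ger0_norm; lra.
  have [j _ hj] := (cvgrPdist_le _ _).1 cv e e0.
  by exists j; have := hj j (leqnn j); rewrite sub0r normrN ger0_norm // exprn_ge0; lra.
exists (j * r).*2 => d le_d hd.
suff: a j <= hit d o <= a j + (1 - delta) ^+ j.
  by move: (a_le j) (le_b j) => ? ? /andP[? ?]; rewrite ler_norml; lra.
have [od|ed] := boolP (odd d).
  (* For odd [d], the bounds at the even time [(j * r).*2] are carried over the remaining steps, the
     closed walk of length [d] itself being the odd one required. *)
  have := between_odd d _ _ (d - (j * r).*2) _ od hd (H j _ (leqnn _)).
  by move=> /(_ o evenly_o); rewrite /hit -iterD subnK.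
rewrite -(even_halfK ed); apply: H evenly_o.
by rewrite -leq_double even_halfK.
Qed.

End Walk.

(** * From return probabilities to the multipermanent *)

Lemma multipermanent_code (R : realType) (m n k : nat) (op : 'I_n -> 'I_n -> 'I_n) :
  multipermanent k (MDS_code R op m) = (@num_multiplex m n k op)%:R.
Proof.
rewrite /multipermanent natr_sum; apply: eq_bigr => K _.
by rewrite natr_prod; apply: eq_bigr => a _; rewrite natrX.
Qed.

Lemma nwalk_hit (R : realType) (V : finType) (B : pred V) (act : V -> V -> V) (o : V)
    (m : nat) (g : V) :
  (0 < #|B|)%N -> (nwalk B act o m g)%:R = hit R V V B act o m g * #|B|%:R ^+ m.
Proof.
move=> B_gt0; elim: m g => [|m IHm] g.
  rewrite /nwalk mulr1 (big_pred1 [ffun i : 'I_0 => o]) => [|F].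
    by rewrite enum_ord0.
  by apply/forallP/eqP => [_|_ []//]; apply/ffunP => -[].
rewrite nwalkS natr_sum (eq_bigr _ (fun f _ => IHm (act g f))) -mulr_suml exprS mulrA.
by congr (_ * _); rewrite /hit /= /avg divfK // pnatr_eq0 -lt0n.
Qed.

(** Let [tau u] solve [(z * u) * x = z]. Cancellation makes [tau] injective, so for balanced [f] the
    function [tau] after [f] is balanced too, and these two steps lead back to the start. *)
Lemma hit2_gt0 (R : realType) (n k : nat) (op : 'I_n -> 'I_n -> 'I_n) (n_gt0 : (0 < n)%N) :
  is_quasigroup op ->
  0 < hit R _ _ (@balanced n k) (pointwise op) (zero_ffun _ _ n_gt0) 2 (zero_ffun _ _ n_gt0).
Proof.
move=> qop; have /card_gt0P[f bf] := balanced_gt0 n k.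
have B_gt0 := balanced_gt0 n k.
pose z := Ordinal n_gt0.
pose tau u := invF (quasigroup_inj_l n op (op z u) qop) z.
have tauK u : op (op z u) (tau u) = z by rewrite /tau f_invF.
have tau_inj : injective tau.
  move=> u v E; apply: (quasigroup_inj_l n op z qop).
  by apply: (quasigroup_inj_r n op (tau u) qop); rewrite tauK E tauK.
apply/(hitS_gt0P R _ _ _ _ _ B_gt0); exists f => //; apply/(hitS_gt0P R _ _ _ _ _ B_gt0).
exists [ffun t => tau (f t)]; first by rewrite balanced_comp_inj.
rewrite /hit /= ltr0n lt0b; apply/eqP/ffunP => t.
by rewrite !ffunE tauK.
Qed.

Lemma pointwise_inj (M n : nat) (op : 'I_n -> 'I_n -> 'I_n) (f : {ffun 'I_M -> 'I_n}) :
  is_quasigroup op -> injective ((pointwise op)^~ f).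
Proof.
move=> qop g h /ffunP E; apply/ffunP => t; move: (E t); rewrite !ffunE.
exact: quasigroup_inj_r.
Qed.

Theorem theorem2 (R : realType) (n : nat) (op : 'I_n -> 'I_n -> 'I_n) (k : nat)
    (n_gt0 : (0 < n)%N) (op_quasigroup : is_quasigroup op) (k_gt0 : (1 <= k)%N) :
  let Per (d : nat) : R := multipermanent k (MDS_code R op d.-1) in
  [/\ forall d : nat, (2 <= d)%N -> ~~ odd d -> 0 < Per d,
      forall d' : nat, (2 <= d')%N -> odd d' -> 0 < Per d' ->
        forall d : nat, (d' <= d)%N -> 0 < Per d
    & exists c : R, 0 < c /\
        (fun d : nat =>
           Per d / (((k * n)`!)%:R / (k`!)%:R ^+ n) ^+ (d - 2))
          @ within [set d : nat | (2 <= d)%N /\ Per d != 0] \oo --> c].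
Proof.
move=> Per.
have N_gt0 := balanced_gt0 n k; set N := #|@balanced n k| in N_gt0.
pose o := zero_ffun (k * n) n n_gt0.
pose p d := hit R _ _ (@balanced n k) (pointwise op) o d o.
have p2 : 0 < p 2%N := hit2_gt0 R n k op n_gt0 op_quasigroup.
have inj_act (f : {ffun 'I_(k * n) -> 'I_n}) : balanced f -> injective ((pointwise op)^~ f).
  by move=> _; apply: pointwise_inj.
have LabE d : (0 < d)%N -> (@num_labelled d.-1 n k op)%:R = p d * N%:R ^+ d.
  move=> d_gt0; rewrite /num_labelled (labelled_walk _ _ _ _ n_gt0) // nwalk_hit //.
  by rewrite prednK.
have NR_gt0 : 0 < N%:R :> R by rewrite ltr0n.
have Per_gt0 d : (2 <= d)%N -> (0 < Per d) = (0 < p d).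
  move=> d2; rewrite /Per multipermanent_code ltr0n num_multiplex_gt0 -(ltr0n R).
  by rewrite LabE ?pmulr_lgt0 ?exprn_gt0 // ltnW.
have p_double m : 0 < p m.*2 by apply: hit_double_gt0.
split=> [d d2 ed|d' d'2 od' hd' d le_d|].
- by rewrite Per_gt0 // -(even_halfK ed).
- have d2 := leq_trans d'2 le_d; rewrite Per_gt0 // in hd'; rewrite Per_gt0 //.
  have [od|ed] := boolP (odd d); last by rewrite -(even_halfK ed).
  rewrite -(subnK le_d); have e : ~~ odd (d - d') by rewrite oddB // od od'.
  by rewrite -(even_halfK e); apply: hitD_gt0 => //; apply: p_double.
have NE : (k * n)`!%:R / k`!%:R ^+ n = N%:R :> R.
  rewrite -(card_balanced n k) natrM natrX mulfK //.
rewrite NE; set S := [set d | _].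
(* For [n = 1], [N] is 1 and every nonzero multipermanent equals 1, so the limit is 1. *)
have [n_gt1|n_le1] := ltnP 1 n; last first.
  have n1 : n = 1%N by lia.
  exists 1; split; first exact: ltr01.
  apply/cvgrPdist_le => e e_gt0; rewrite near_withinE; near=> d => -[d2 Per_neq0].
  suff -> : Per d / N%:R ^+ (d - 2) = 1 by rewrite subrr normr0 ltW.
  have -> : N = 1%N.
    have := card_balanced n k; rewrite -/N n1 muln1 expn1 => /eqP.
    by rewrite -[X in _ == X]mul1n eqn_pmul2r ?fact_gt0 // => /eqP.
  rewrite expr1n divr1; move: Per_neq0; rewrite /Per multipermanent_code pnatr_eq0 -lt0n.
  have : (@num_multiplex d.-1 n k op <= 1)%N.
    move: op {op_quasigroup Per Per_gt0 LabE p2 p_double p S inj_act}.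
    by rewrite n1 => op; apply: num_multiplex1.
  by case: num_multiplex => [|[]].
have [c c_gt0 c_lim] := hit_cvg R _ _ _ _ o N_gt0 inj_act p2.
pose M := (k * n)`!; have M_gt0 : 0 < M%:R :> R by rewrite ltr0n fact_gt0.
have [T TE] : exists T, T = ((k * n) ^ 2)%N by eexists.
(* There are [p d * N ^ d] labellings, about [M] for each multiplex, and the normalisation by
   [N ^ (d - 2)] leaves [N ^ 2]. *)
exists (N%:R ^+ 2 / M%:R * c); split.
  by rewrite mulr_gt0 // divr_gt0 // exprn_gt0.
have p_cvg : p d @[d --> within S \oo] --> c.
  apply/cvgrPdist_le => e /c_lim[D HD]; rewrite near_withinE.
  exists D => // d /= le_d [d2 Pd]; apply: HD => //.
  by rewrite -/(p d) -Per_gt0 // lt0r Pd /Per multipermanent_code ler0n.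
have q_cvg : (N.-1%:R / N%:R) ^+ d @[d --> within S \oo] --> (0 : R).
  apply: cvg_within_filter; apply: cvg_expr.
  rewrite ger0_norm ?divr_ge0 ?ler0n // ltr_pdivrMr // mul1r ltr_nat.
  by rewrite prednK.
have lo_cvg : N%:R ^+ 2 / M%:R * p d @[d --> within S \oo] --> N%:R ^+ 2 / M%:R * c.
  by apply: cvgM => //; apply: cvg_cst.
have hi_cvg : N%:R ^+ 2 / M%:R * p d + T%:R * N%:R ^+ 2 * (N.-1%:R / N%:R) ^+ d
    @[d --> within S \oo] --> N%:R ^+ 2 / M%:R * c.
  rewrite -[X in _ --> X]addr0; apply: cvgD => //.
  by rewrite -[X in _ --> X](mulr0 (T%:R * N%:R ^+ 2)); apply: cvgM => //; apply: cvg_cst.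
(* The lower bound is [num_labelled_le]; the upper one is [num_multiplex_excess], whose error term
   decays like the powers of [(N - 1) / N]. *)
apply: (squeeze_cvgr _ lo_cvg hi_cvg).
rewrite near_withinE; near=> d => -[d2 _].
have Nd : N%:R ^+ d = N%:R ^+ (d - 2) * N%:R ^+ 2 :> R by rewrite -exprD subnK.
have Nd2_gt0 : 0 < N%:R ^+ (d - 2) :> R by rewrite exprn_gt0.
have d_gt0 : (0 < d)%N by apply: ltnW.
have lo := num_labelled_le d.-1 n k op.
have hi := num_multiplex_excess d.-1 n k op n_gt1 k_gt0.
rewrite -(ler_nat R) natrM LabE // -/M Nd in lo.
rewrite -(ler_nat R) -/N -/M -TE natrD !natrM LabE // prednK // natrX Nd in hi.
rewrite /Per multipermanent_code expr_div_n Nd; set x := _ ^+ (d - 2) in lo hi Nd2_gt0 *.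
have [x0 N0 M0] : [/\ x != 0, N%:R != 0 :> R & M%:R != 0 :> R] by rewrite !gt_eqF.
apply/andP; split; rewrite ?ler_pdivlMr ?ler_pdivrMr // -(ler_pM2l M_gt0).
  by apply: le_trans lo; rewrite le_eqVlt; apply/orP; left; apply/eqP; field.
apply: le_trans hi _; rewrite le_eqVlt; apply/orP; left; apply/eqP; field.
by rewrite x0 N0.
Unshelve. all: by end_near.
Qed.
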